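(* Let $R$ be a finite minimal simple ring. Then $R\in\Delta$, where $$\Delta=\{T,\ T\oplus \mathbb{Z}_n \mid n\geq 2 \text{ and } T \text{ is a purely minimal simple ring}\};$$ that is, $R$ is isomorphic either to a purely minimal simple ring $T$ or to $T\oplus\mathbb{Z}_n$ for some purely minimal simple ring $T$ and some integer $n\geq 2$.
   Context: All rings are unitary (associative with identity, not necessarily commutative). A unitary subring of $R$ is a subring containing the identity of $R$. $R^*$ denotes the group of units of $R$, and $\mathbb{Z}_n$ is the ring of integers modulo $n$. Membership in $\Delta$ is understood up to ring isomorphism. A finite ring $R$ is called minimal simple if $R^*$ is not a solvable group but $S^*$ is a solvable group for every proper unitary subring $S$ of $R$. (This does not mean that $R$ is a simple ring.) A ring $R$ is called purely minimal simple if $R$ is a minimal simple ring of order $p^m$, for some prime $p$ and some integer $m$, such that $R$ is not a direct sum of two proper ideals. *)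

(* Defs.v *)
From HB Require Import structures.
From mathcomp Require Import all_boot all_order all_algebra.
From mathcomp Require Import all_fingroup all_solvable.

Set Implicit Arguments.
Unset Strict Implicit.
Unset Printing Implicit Defensive.

Import GRing.Theory.
Local Open Scope ring_scope.

(* Finite rings are taken as [finUnitRingType]: on a finite nonzero ring the
   unit structure exists and is determined by the multiplication.  The zero
   ring, which this excludes, has a trivial unit group and so is never
   minimal simple. *)

(* The unit group S^* of a unitary subring S of R, inside R^* = {unit R}:
   a unit of S is an element of S with a two-sided inverse lying in S. *)
Definition subring_units (R : finUnitRingType) (S : {set R}) :
    {set {unit R}} :=
  [set u : {unit R} | (val u \in S) && (val u^-1%g \in S)].

(* [solvable] accepts arbitrary sets; on the sets it is applied to below,
   it is genuine solvability of a group. *)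
Lemma subring_units_group_set (R : finUnitRingType) (S : {set R}) :
  subring_closed S -> group_set (subring_units S).
Proof.
case=> S1 _ SM; apply/group_setP; split.
  by rewrite inE invg1 /= S1.
move=> u v; rewrite !inE => /andP[Su Su'] /andP[Sv Sv'].
by rewrite invMg /= !SM.
Qed.

Definition minimal_simple (R : finUnitRingType) : Prop :=
  ~~ solvable [set: {unit R}] /\
  forall S : {set R}, subring_closed S -> S \proper [set: R] ->
    solvable (subring_units S).

Definition two_sided_ideal (R : finUnitRingType) (I : {set R}) : Prop :=
  zmod_closed I /\ forall a x : R, x \in I -> (a * x \in I) && (x * a \in I).

Definition direct_sum_of_proper_ideals (R : finUnitRingType) : Prop :=
  exists I J : {set R},
    [/\ two_sided_ideal I /\ I \proper [set: R],
        two_sided_ideal J /\ J \proper [set: R],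
        forall x : R, exists i j, [/\ i \in I, j \in J & x = i + j]
      & I :&: J = [set 0]].

Definition purely_minimal_simple (R : finUnitRingType) : Prop :=
  [/\ minimal_simple R,
      exists p m : nat, prime p /\ #|R| = (p ^ m)%N
    & ~ direct_sum_of_proper_ideals R].

Definition ring_isomorphic (R S : nzRingType) : Prop :=
  exists f : {rmorphism R -> S}, bijective f.

(* Membership in the class Delta, up to isomorphism.  ['Z_n] is Z/nZ exactly
   because [1 < n]; the product type carries the componentwise ring
   structure. *)
Definition in_Delta (R : finUnitRingType) : Prop :=
  exists T : finUnitRingType, purely_minimal_simple T /\
    (ring_isomorphic R T \/
     exists n : nat, (1 < n)%N /\ ring_isomorphic R (T * 'Z_n)%type).

(* Main.v *)
Require Import Defs.
From HB Require Import structures.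
From mathcomp Require Import all_boot all_order all_algebra.
From mathcomp Require Import all_fingroup all_solvable.

Set Implicit Arguments.
Unset Strict Implicit.
Unset Printing Implicit Defensive.

Import GRing.Theory.
Local Open Scope ring_scope.

(** Central idempotents e of R correspond to the factors eR in decompositions
    R = eR * (1 - e)R, and the unit group of eR sits inside that of R as the
    group [corner_units e] of units whose component in (1 - e)R is 1.  If
    f = e * f is another central idempotent, every element of [corner_units e]
    is a product of elements of [corner_units f] and [corner_units (e - f)], and
    these groups are normal; so if eR has a nonsolvable unit group, then so has
    fR or (e - f)R ([solvable_corner_units]).  Choosing e such that the unit
    group of eR is nonsolvable and eR is as small as possible therefore gives a
    primitive central idempotent ([exists_primitive_nonsolvable_corner]).

    The factor T is this eR.  It is indecomposable because a splitting of eR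
    yields a central idempotent of R strictly between 0 and e; its
    characteristic is a prime power because otherwise the Chinese remainder
    theorem produces such an idempotent among the integer multiples of e; hence
    its order is a prime power as well.

    Minimality of R is used twice, each time on a subring containing enough
    units.  A proper subring of eR with nonsolvable units pulls back along
    R -> eR to a proper subring of R with nonsolvable units, so eR is minimal
    simple ([corner_minimal_simple]).  The subring of those x whose component in
    (1 - e)R is an integer multiple of 1 - e contains all of [corner_units e],
    so it is R ([corner_complement_prime_ring]): (1 - e)R is its own prime ring,
    which is 0 if e = 1 and Z/n with n > 1 otherwise. *)

(** * Central idempotents and the units of their corners *)

Section CentralIdempotents.

Variable R : finUnitRingType.
Implicit Types (e f x : R) (u v : {unit R}).

Definition central_idempotent e :=
  (e * e == e) && [forall x, e * x == x * e].

Lemma central_idempotentP e :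
  reflect (e * e = e /\ forall x, e * x = x * e) (central_idempotent e).
Proof.
apply: (iffP andP) => -[/eqP ee ce]; split=> //.
- by move=> x; apply/eqP/(forallP ce).
- by apply/forallP=> x; rewrite ce.
Qed.

Lemma central_idempotent1 : central_idempotent 1.
Proof. by apply/central_idempotentP; split=> [|x]; rewrite ?mulr1 ?mul1r. Qed.

Lemma central_idempotentB e f :
  central_idempotent e -> central_idempotent f -> e * f = f ->
  central_idempotent (e - f).
Proof.
move=> /central_idempotentP[ee ce] /central_idempotentP[ff cf] ef.
apply/central_idempotentP; split=> [|x]; last by rewrite mulrBl mulrBr ce cf.
by rewrite mulrBl !mulrBr ee ef -ce ef ff subrr subr0.
Qed.

Section Complement.

Variables (f : R) (cif : central_idempotent f).

Lemma central_idempotentC : central_idempotent (1 - f).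
Proof. by rewrite central_idempotentB ?mul1r ?central_idempotent1. Qed.

Lemma mulr_idemC : f * (1 - f) = 0.
Proof.
by have /central_idempotentP[ff _] := cif; rewrite mulrBr mulr1 ff subrr.
Qed.

Lemma mulr_Cidem : (1 - f) * f = 0.
Proof.
by have /central_idempotentP[_ ->] := central_idempotentC; exact: mulr_idemC.
Qed.

Lemma mulr_CC : (1 - f) * (1 - f) = 1 - f.
Proof. by have /central_idempotentP[] := central_idempotentC. Qed.

End Complement.

(** The units of the form (v, 1) in eR * (1 - e)R: a copy of the unit group of
    eR inside {unit R}, available without constructing the ring eR. *)
Definition corner_units e : {set {unit R}} :=
  [set u : {unit R} | val u * (1 - e) == 1 - e].

Lemma corner_units_group_set e : group_set (corner_units e).
Proof.
apply/group_setP; split=> [|u v]; rewrite !inE /= ?mul1r // => /eqP hu /eqP hv.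
by rewrite -mulrA hv hu.
Qed.

Canonical corner_units_group e := Group (corner_units_group_set e).

Lemma corner_units1 : corner_units 1 = [set: {unit R}].
Proof. by apply/setP=> u; rewrite !inE subrr mulr0 eqxx. Qed.

Lemma corner_units_norm e :
  central_idempotent e -> [set: {unit R}] \subset 'N(corner_units e)%g.
Proof.
move=> /central_idempotentP[_ ce].
have c1e x : x * (1 - e) = (1 - e) * x by rewrite mulrBr mulrBl mulr1 mul1r ce.
apply/subsetP=> u _; rewrite inE; apply/subsetP=> _ /imsetP[v hv ->].
move: hv; rewrite !inE !FinRing.val_unitM FinRing.val_unitV => /eqP hv.
by rewrite -!mulrA c1e (mulrA (val v)) hv -c1e mulKr ?(valP u).
Qed.

(** In R = fR * (1 - f)R, this replaces the second component of x by 1. *)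
Definition cut f x := x * f + (1 - f).

Lemma cutM f : central_idempotent f -> {morph cut f : x y / x * y}.
Proof.
move=> cif x y; have /central_idempotentP[ff cf] := cif.
rewrite /cut; move: (mulr_idemC cif) (mulr_Cidem cif) (mulr_CC cif).
move: (1 - f) => g fg gf gg.
rewrite mulrDl !mulrDr gg -(mulrA x f g) fg mulr0 addr0.
rewrite -(cf y) (mulrA g) gf mul0r add0r.
by rewrite -(mulrA x f) (mulrA f) ff cf mulrA.
Qed.

Lemma cut_unit f u :
  central_idempotent f -> cut f (val u) \is a GRing.unit.
Proof.
move=> cf; have cut1 : cut f 1 = 1 by rewrite /cut mul1r addrC subrK.
apply/unitrP; exists (cut f (val u)^-1).
by rewrite -!cutM // mulVr ?mulrV ?(valP u).
Qed.

(** A unit (a, b, 1) of R = fR * (e - f)R * (1 - e)R is the product of (a, 1, 1)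
    and (1, b, 1). *)
Lemma corner_units_sub_mul e f :
  central_idempotent f -> e * f = f ->
  corner_units e \subset (corner_units f * corner_units (e - f))%g.
Proof.
move=> cif ef; have cif' := central_idempotentC cif.
have /central_idempotentP[ff cf] := cif.
have fg := mulr_idemC cif; have gf := mulr_Cidem cif; have gg := mulr_CC cif.
apply/subsetP=> u; rewrite inE => /eqP ue; apply/mulsgP.
exists (FinRing.Unit (cut_unit u cif)) (FinRing.Unit (cut_unit u cif')).
- by rewrite inE /= /cut mulrDl -mulrA fg mulr0 add0r gg.
- have fe0 : f * (1 - e) = 0 by rewrite mulrBr mulr1 cf ef subrr.
  have ge1 : (1 - f) * (1 - e) = 1 - e by rewrite mulrBl mul1r fe0 subr0.
  rewrite inE /= /cut subKr.
  have -> : 1 - (e - f) = (1 - e) + f by rewrite opprB addrA addrAC.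
  move: (1 - f) (1 - e) gf ue fe0 ge1 => g h gf ue fe0 ge1.
  by rewrite mulrDr !mulrDl fe0 ff -!mulrA gf ge1 ue mulr0 add0r addr0.
- apply: val_inj => /=; rewrite /cut subKr.
  (* The cross terms on the right vanish, leaving u * f + u * (1 - f). *)
  rewrite -[LHS]mulr1 -{1}(subrK f 1).
  have /central_idempotentP[_] := cif'.
  move: (1 - f) fg gf gg => g fg gf gg cg.
  rewrite mulrDl !mulrDr gf addr0 -(mulrA _ f f) ff (mulrA g) cg.
  rewrite -(mulrA _ g g) gg.
  by rewrite -(mulrA _ f) (mulrA f) cf -(mulrA _ f g) fg !mulr0 add0r addrC.
Qed.

(** The quotient of [corner_units e] by its normal subgroup [corner_units f] is
    an image of a subgroup of [corner_units (e - f)]. *)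
Lemma solvable_corner_units e f :
  central_idempotent f -> e * f = f ->
  solvable (corner_units f) -> solvable (corner_units (e - f)) ->
  solvable (corner_units e).
Proof.
move=> cif ef solf solef.
have nUf : corner_units (e - f) \subset 'N(corner_units f)%g.
  exact: subset_trans (subsetT _) (corner_units_norm cif).
have := corner_units_sub_mul cif ef; rewrite -norm_joinEr //.
move/solvableS; apply.
have nY : (corner_units f <| corner_units f <*> corner_units (e - f))%g.
  by rewrite normalYl.
by rewrite (series_sol nY) solf quotientYidl // quotient_sol.
Qed.

End CentralIdempotents.

(** * The corner ring *)

(** The bundling makes the ring structure of the corner inferable. *)
Record nonzero_central_idempotent (R : finUnitRingType) :=
  NonzeroCentralIdempotent {
  idem : R;
  idem_central : central_idempotent idem;
  idem_neq0 : idem != 0 }.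

Section CornerRing.

Variables (R : finUnitRingType) (E : nonzero_central_idempotent R).
Local Notation e := (idem E).

Record corner := Corner { corner_val : R; _ : e * corner_val == corner_val }.

HB.instance Definition _ := [isSub for corner_val].
HB.instance Definition _ := [Finite of corner by <:].

Implicit Types s t : corner.

Let idemM : e * e = e.
Proof. by have /central_idempotentP[] := idem_central E. Qed.

Let idemC x : e * x = x * e.
Proof. by have /central_idempotentP[_ ->] := idem_central E. Qed.

Lemma corner_idl t : e * val t = val t. Proof. exact/eqP/(valP t). Qed.
Lemma corner_idr t : val t * e = val t. Proof. by rewrite -idemC corner_idl. Qed.

Fact corner_zmod_closed : zmod_closed [pred x : R | e * x == x].
Proof.
split=> [|x y]; rewrite !inE ?mulr0 // => /eqP hx /eqP hy.
by rewrite mulrBr hx hy.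
Qed.

HB.instance Definition _ :=
  GRing.SubChoice_isSubZmodule.Build R _ corner corner_zmod_closed.

Lemma corner_valD s t : val (s + t) = val s + val t. Proof. by []. Qed.

Fact to_corner_proof x : e * (e * x) == e * x.
Proof. by rewrite mulrA idemM. Qed.
Definition to_corner x : corner := Corner (to_corner_proof x).

Definition corner_one := to_corner 1.
Definition corner_mul s t := to_corner (val s * val t).

Fact corner_mulE s t : val (corner_mul s t) = val s * val t.
Proof. by rewrite /= mulrA corner_idl. Qed.

Fact corner_mulA : associative corner_mul.
Proof. by move=> r s t; apply: val_inj; rewrite !corner_mulE mulrA. Qed.
Fact corner_mul1r : left_id corner_one corner_mul.
Proof. by move=> t; apply: val_inj; rewrite corner_mulE /= mulr1 corner_idl. Qed.
Fact corner_mulr1 : right_id corner_one corner_mul.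
Proof. by move=> t; apply: val_inj; rewrite corner_mulE /= mulr1 corner_idr. Qed.
Fact corner_mulDl : left_distributive corner_mul +%R.
Proof.
move=> r s t; apply: val_inj.
by rewrite corner_valD !corner_mulE corner_valD mulrDl.
Qed.
Fact corner_mulDr : right_distributive corner_mul +%R.
Proof.
move=> r s t; apply: val_inj.
by rewrite corner_valD !corner_mulE corner_valD mulrDr.
Qed.
Fact corner_one_neq0 : corner_one != 0.
Proof. by rewrite -val_eqE /= mulr1 idem_neq0. Qed.

HB.instance Definition _ := GRing.Zmodule_isNzRing.Build corner
  corner_mulA corner_mul1r corner_mulr1 corner_mulDl corner_mulDr
  corner_one_neq0.

Lemma corner_val1 : val (1 : corner) = e. Proof. exact: mulr1. Qed.
Lemma corner_valM s t : val (s * t) = val s * val t.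
Proof. exact: corner_mulE. Qed.

HB.instance Definition _ := FinRing.isNzRing.Build corner.

Lemma to_corner_val t : to_corner (val t) = t.
Proof. by apply: val_inj; rewrite /= corner_idl. Qed.

Lemma to_cornerM x y : to_corner (x * y) = to_corner x * to_corner y.
Proof.
apply: val_inj; rewrite corner_valM /= -(mulrA e x) (mulrA x) -idemC.
by rewrite -(mulrA e x) (mulrA e e) idemM.
Qed.

(** The pair (t, 1) of eR * (1 - e)R: unlike [val], this sends 1 to 1 and hence
    units to units. *)
Definition corner_embed t : R := val t + (1 - e).

Lemma corner_embed1 : corner_embed 1 = 1.
Proof. by rewrite /corner_embed corner_val1 addrC subrK. Qed.

Lemma corner_embedM : {morph corner_embed : s t / s * t}.
Proof.
move=> s t; rewrite /corner_embed corner_valM.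
have s0 : val s * (1 - e) = 0 by rewrite mulrBr mulr1 corner_idr subrr.
have t0 : (1 - e) * val t = 0 by rewrite mulrBl mul1r corner_idl subrr.
move: (1 - e) (mulr_CC (idem_central E)) s0 t0 => g gg s0 t0.
by rewrite mulrDl !mulrDr s0 t0 gg addr0 add0r.
Qed.

Fact corner_embed_unit (u : {unit corner}) :
  corner_embed (val u) \is a GRing.unit.
Proof.
apply/unitrP; exists (corner_embed (val u)^-1).
by rewrite -!corner_embedM mulVr ?mulrV ?(valP u) // corner_embed1.
Qed.

Definition corner_embedu u : {unit R} := FinRing.Unit (corner_embed_unit u).

Lemma corner_embeduM :
  {in [set: {unit corner}] &, {morph corner_embedu : u v / (u * v)%g}}.
Proof. by move=> u v _ _; apply: val_inj; rewrite /= corner_embedM. Qed.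
Canonical corner_embedu_morphism := Morphism corner_embeduM.

Lemma injm_corner_embedu : ('injm corner_embedu)%g.
Proof.
apply/injmP=> u v _ _ /(congr1 val) /= /addIr huv.
by apply/val_inj/val_inj.
Qed.

Lemma corner_embedu_im :
  (corner_embedu @* [set: {unit corner}])%g = corner_units e.
Proof.
apply/setP=> u; apply/morphimP/idP => [[t _ _ ->]|].
  rewrite inE /= /corner_embed mulrDl mulrBr mulr1 corner_idr subrr add0r.
  by rewrite mulrBr mulr1 mulrBl mul1r idemM subrr subr0.
rewrite inE => /eqP ue.
have inv1 (v : {unit R}) : to_corner (val v) \is a GRing.unit.
  apply/unitrP; exists (to_corner (val v)^-1).
  by rewrite -!to_cornerM mulVr ?mulrV ?(valP v).
exists (FinRing.Unit (inv1 u)); rewrite ?inE //.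
apply: val_inj; rewrite /= /corner_embed /= -ue mulrBr mulr1 idemC.
by rewrite addrCA subrr addr0.
Qed.

End CornerRing.

(** * Primitive central idempotents *)

Definition primitive_central_idempotent (R : finUnitRingType) (e : R) :=
  [/\ central_idempotent e, e != 0
    & forall f, central_idempotent f -> e * f = f -> f = 0 \/ f = e].

Lemma solvable_corner_units0 (R : finUnitRingType) :
  solvable (corner_units (0 : R)).
Proof.
suff -> : corner_units (0 : R) = 1%g by apply: solvable1.
by apply/setP=> u; rewrite !inE subr0 mulr1.
Qed.

(** Take e of least size of eR among the central idempotents for which
    [corner_units e] is nonsolvable: of two orthogonal parts f and e - f, one has
    the same property and must therefore be all of e. *)
Lemma exists_primitive_nonsolvable_corner (R : finUnitRingType) :
  ~~ solvable [set: {unit R}] ->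
  exists2 e : R, primitive_central_idempotent e & ~~ solvable (corner_units e).
Proof.
move=> nsolR.
pose P (e : R) := central_idempotent e && ~~ solvable (corner_units e).
have P1 : P 1 by rewrite /P central_idempotent1 corner_units1.
case: (arg_minnP (fun e => #|[set e * x | x : R]|) P1) => e.
move=> /andP[cie nsole] mine.
exists e => //; split=> // [|f cif ef].
  by apply: contraNneq nsole => ->; apply: solvable_corner_units0.
have /central_idempotentP[ee ce] := cie.
have full g : central_idempotent g -> e * g = g ->
    ~~ solvable (corner_units g) -> g = e.
  move=> cig eg nsolg; have /central_idempotentP[gg cg] := cig.
  have sge : [set g * x | x : R] \subset [set e * x | x : R].
    apply/subsetP=> _ /imsetP[x _ ->]; apply/imsetP.
    by exists (g * x); rewrite // mulrA eg.
  have ge : [set g * x | x : R] = [set e * x | x : R].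
    by apply/eqP; rewrite eqEcard sge mine // /P cig nsolg.
  have : e \in [set g * x | x : R] by rewrite ge; apply/imsetP; exists e.
  by case/imsetP=> x _ ex; rewrite -eg ce {1}ex mulrA gg -ex.
case: (boolP (solvable (corner_units f))) => [solf|nsolf]; last first.
  by right; apply: full.
left; have efe : e - f = e.
  apply: full; first exact: central_idempotentB.
    by rewrite mulrBr ee ef.
  by apply: contra nsole; apply: solvable_corner_units.
by rewrite -(subKr e f) efe subrr.
Qed.

(** If the order n of e is a product of coprime a and b, the multiple of e by an
    integer that is 1 mod a and 0 mod b is a central idempotent; being 0 or e,
    it forces a = 1 or b = 1. *)
Lemma primitive_central_idempotent_order (R : finUnitRingType) (e : R) :
  primitive_central_idempotent e ->
  exists2 p, prime p & (p.-nat #[e]%g).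
Proof.
move=> [cie e0 prime_e]; set n := #[e]%g.
have /central_idempotentP[ee ce] := cie.
have natE i j : (e *+ i == e *+ j) = (i == j %[mod n]).
  by rewrite -!FinRing.zmodXgE eq_expg_mod_order.
have n_gt1 : (1 < n)%N by rewrite order_gt1.
have pr_p := pdiv_prime n_gt1; set p := pdiv n in pr_p.
exists p => //; pose a := (n`_p)%N; pose b := (n`_p^')%N.
have co_ab : coprime a b by apply: coprime_partC.
have nab : (a * b)%N = n by apply: partnC; apply: ltnW.
pose w := chinese a b 1 0.
have wa : w = 1 %[mod a] by apply: chinese_modl.
have wb : w = 0 %[mod b] by apply: chinese_modr.
have ciw : central_idempotent (e *+ w).
  apply/central_idempotentP; split=> [|x]; last by rewrite mulrnAl mulrnAr ce.
  apply/eqP; rewrite mulrnAl mulrnAr ee -mulrnA natE -nab chinese_remainder //.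
  by rewrite -modnMm wa modnMm -[in X in _ && X](modnMm w w b) wb modnMm !eqxx.
have ew : e * (e *+ w) = e *+ w by rewrite mulrnAr ee.
case: (prime_e _ ciw ew) => /eqP.
- rewrite -(mulr0n e) natE -nab chinese_remainder // wa => /andP[/eqP a1 _].
  have : (a %| 1)%N by rewrite /dvdn a1 mod0n.
  rewrite dvdn1 p_part_eq1 => /negP[].
  by rewrite mem_primes pr_p pdiv_dvd ltnW.
- rewrite -{2}(mulr1n e) natE -nab chinese_remainder // wb => /andP[_ /eqP b1].
  have : (b %| 1)%N by rewrite /dvdn -b1 mod0n.
  by rewrite dvdn1 => /eqP b_1; rewrite b_1 muln1 part_pnat.
Qed.

(** The integer n kills every element, so the additive group has exponent
    dividing n. *)
Lemma pnat_card_finring (T : finNzRingType) (p n : nat) :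
  n%:R = 0 :> T -> p.-nat n -> p.-nat #|T|.
Proof.
move=> n0 pn; rewrite -cardsT -[p.-nat _]/(p.-group [set: T])%g -pnat_exponent.
apply: pnat_dvd pn; apply/exponentP=> t _.
by rewrite FinRing.zmodXgE -mulr_natl n0 mul0r.
Qed.

Lemma corner_card_prime_power (R : finUnitRingType)
    (E : nonzero_central_idempotent R) :
  primitive_central_idempotent (idem E) ->
  exists p m : nat, prime p /\ #|{: corner E}| = (p ^ m)%N.
Proof.
move=> prime_e; have [p pr_p pe] := primitive_central_idempotent_order prime_e.
have n0 : (#[idem E]%g)%:R = 0 :> corner E.
  by apply: val_inj; rewrite raddfMn /= mulr1 -FinRing.zmodXgE expg_order.
have pT := pnat_card_finring n0 pe.
by exists p, (logn p #|{: corner E}|); split; rewrite // -p_part part_pnat_id.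
Qed.

(** The component i of 1 = i + j works: i * j and every i * t - t * i lie in
    both ideals, so they vanish. *)
Lemma direct_sum_central_idempotent (T : finUnitRingType) :
  direct_sum_of_proper_ideals T ->
  exists i : T, [/\ central_idempotent i, i != 0 & i != 1].
Proof.
move=> [I [J [[tsI pI] [tsJ pJ] sumIJ IJ0]]].
have [[_ IB] idI] := tsI; have [[_ JB] idJ] := tsJ.
have [i [j [iI jJ ij1]]] := sumIJ 1.
have IJ t : t \in I -> t \in J -> t = 0.
  by move=> tI tJ; apply/set1P; rewrite -IJ0 inE tI.
have n1 (K : {set T}) : two_sided_ideal K -> K \proper setT -> 1 \notin K.
  move=> [_ idK] pK; apply: contraTN pK => K1; rewrite properT negbK.
  by apply/eqP/setP=> t; have /andP[] := idK t 1 K1; rewrite mulr1 inE => ->.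
have ii : i * i = i.
  rewrite -[RHS]mulr1 ij1 mulrDr; suff -> : i * j = 0 by rewrite addr0.
  by apply: IJ; [have /andP[] := idI j i iI | have /andP[] := idJ i j jJ].
have ci t : i * t = t * i.
  apply/eqP; rewrite -subr_eq0; apply/eqP/IJ.
    by apply: IB; have /andP[] := idI t i iI.
  have -> : i = 1 - j by rewrite ij1 addrK.
  rewrite mulrBl mulrBr mul1r mulr1 opprB addrCA addrAC subrr add0r.
  by apply: JB; have /andP[] := idJ t j jJ.
exists i; split; first by apply/central_idempotentP.
- apply: contraTneq jJ => i0; have -> : j = 1 by rewrite ij1 i0 add0r.
  exact: n1.
- by apply: contraTneq iI => ->; apply: n1.
Qed.

Lemma corner_indecomposable (R : finUnitRingType)
    (E : nonzero_central_idempotent R) :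
  primitive_central_idempotent (idem E) ->
  ~ direct_sum_of_proper_ideals (corner E).
Proof.
move=> [_ _ prime_e] /direct_sum_central_idempotent[i [cii i0 i1]].
have /central_idempotentP[ii ci] := cii.
(* An element central in eR is central in R, as it only sees the part of x in
   eR. *)
have civ : central_idempotent (val i).
  apply/central_idempotentP; split=> [|x]; first by rewrite -corner_valM ii.
  have /central_idempotentP[_ ce] := idem_central E.
  transitivity (val (i * to_corner E x)).
    by rewrite corner_valM /= mulrA corner_idr.
  by rewrite ci corner_valM /= ce -mulrA corner_idl.
case: (prime_e _ civ (corner_idl i)) => [iv0|ive].
  by case/eqP: i0; apply: val_inj.
by case/eqP: i1; apply: val_inj; rewrite corner_val1.
Qed.

(** * Consequences of minimality *)

(** A subring S of eR pulls back to the subring S' of all x with e * x in S, and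
    [corner_embedu] maps the units of S injectively to units of S'. *)
Lemma corner_minimal_simple (R : finUnitRingType)
    (E : nonzero_central_idempotent R) :
  minimal_simple R -> ~~ solvable (corner_units (idem E)) ->
  minimal_simple (corner E).
Proof.
move=> simR nsole; split.
  apply: contra nsole => /(morphim_sol (corner_embedu_morphism E)).
  by rewrite /= corner_embedu_im.
move=> S cS pS; have [S1 SB SM] := cS.
pose S' : {set R} := [set x | to_corner E x \in S].
have toB x y : to_corner E (x - y) = to_corner E x - to_corner E y.
  by apply: val_inj; rewrite raddfB /= mulrBr.
have cS' : subring_closed S'.
  split=> [|x y|x y]; rewrite !inE //; first by rewrite toB; apply: SB.
  by rewrite to_cornerM; apply: SM.
have pS' : S' \proper [set: R].
  rewrite properT; apply: contraTneq pS => S'T; rewrite properT negbK.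
  by apply/eqP/setP=> t; move/setP/(_ (val t)): S'T; rewrite !inE to_corner_val.
have solS' := simR.2 _ cS' pS'.
pose G := Group (subring_units_group_set cS).
pose G' := Group (subring_units_group_set cS').
have toemb t : to_corner E (corner_embed t) = t.
  apply: val_inj; rewrite /= /corner_embed mulrDr mulr_idemC ?idem_central //.
  by rewrite corner_idl addr0.
rewrite -[subring_units S]/(gval G) -(injm_sol (injm_corner_embedu E)) ?subsetT //.
apply: (@solvableS _ G'); last exact: solS'.
apply/subsetP=> _ /morphimP[u _ uS ->]; move: uS; rewrite !inE -morphV ?inE //=.
by rewrite !toemb.
Qed.

(** The elements with this property form a subring, and the units it contains
    include the nonsolvable group [corner_units e], with k = 1. *)
Lemma corner_complement_prime_ring (R : finUnitRingType) (e : R) :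
  minimal_simple R -> central_idempotent e -> ~~ solvable (corner_units e) ->
  forall x, exists k, (1 - e) * x = (1 - e) *+ k.
Proof.
move=> [_ minR] cie nsole.
pose n := #[1 - e]%g.
pose S : {set R} := [set x | [exists k : 'I_n, (1 - e) * x == (1 - e) *+ k]].
have SP x : reflect (exists k, (1 - e) * x = (1 - e) *+ k) (x \in S).
  rewrite inE; apply: (iffP existsP) => [[k /eqP ->]|[k ->]]; first by exists k.
  exists (Ordinal (ltn_pmod k (order_gt0 (1 - e)))).
  by rewrite /= -!FinRing.zmodXgE expg_mod_order.
have cS : subring_closed S.
  split=> [|x y /SP[k xk] /SP[l yl]|x y /SP[k xk] /SP[l yl]]; apply/SP.
  - by exists 1%N; rewrite mulr1.
  (* The coefficient of -y must be a natural number: use -l modulo n. *)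
  - exists (k + (n - (l %% n)%N))%N; rewrite mulrBr xk yl; apply/eqP.
    rewrite subr_eq -mulrnDr -!FinRing.zmodXgE eq_expg_mod_order -/n.
    suff nl : (n - l %% n + l = 0 %[mod n])%N.
      by rewrite -addnA -modnDmr nl modnDmr addn0.
    by rewrite -modnDmr subnK ?modnn ?mod0n // ltnW // ltn_pmod ?order_gt0.
  - by exists (k * l)%N; rewrite mulrA xk mulrnAl yl -mulrnA mulnC.
have sUS : corner_units e \subset subring_units S.
  have US u : u \in corner_units e -> val u \in S.
    rewrite inE => /eqP ue; apply/SP; exists 1%N.
    by have /central_idempotentP[_ ->] := central_idempotentC cie; rewrite ue.
  by apply/subsetP=> u Uu; rewrite inE (US u Uu) (US u^-1%g) ?groupV.
have ST : S = setT.
  apply/eqP; rewrite -[_ == _]negbK -properT; apply: contra nsole => pS.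
  pose G := Group (subring_units_group_set cS).
  exact: (@solvableS _ G _ sUS (minR S cS pS)).
by move=> x; apply/SP; rewrite ST inE.
Qed.

Lemma bijective_ring_isomorphic (A B : nzRingType) (f : {rmorphism A -> B}) :
  bijective f -> ring_isomorphic B A.
Proof.
case=> g fK gK.
pose gA := GRing.isZmodMorphism.Build B A g (can2_zmod_morphism fK gK).
pose gM := GRing.isMonoidMorphism.Build B A g (can2_monoid_morphism fK gK).
pose G : {rmorphism B -> A} := HB.pack g gA gM.
by exists G; exists f.
Qed.

(** * The decomposition of R *)

Section Decomposition.

Variables (R : finUnitRingType) (E : nonzero_central_idempotent R).
Local Notation e := (idem E).

Lemma ring_isomorphic_corner1 : e = 1 -> ring_isomorphic R (corner E).
Proof.
move=> e1.
have valB : zmod_morphism (val : corner E -> R) by move=> s t; rewrite raddfB.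
have valM : monoid_morphism (val : corner E -> R).
  by split=> [|s t]; rewrite ?corner_val1 ?corner_valM.
pose f : {rmorphism corner E -> R} := HB.pack (val : corner E -> R)
  (GRing.isZmodMorphism.Build _ _ _ valB) (GRing.isMonoidMorphism.Build _ _ _ valM).
apply: (@bijective_ring_isomorphic _ _ f).
exists (to_corner E) => [t|x] /=; first exact: to_corner_val.
by rewrite e1 mul1r.
Qed.

Lemma ring_isomorphic_corner_prod :
  e != 1 -> (forall x, exists k, (1 - e) * x = (1 - e) *+ k) ->
  exists n : nat, (1 < n)%N /\ ring_isomorphic R (corner E * 'Z_n)%type.
Proof.
move=> e1 primeC; have cie := idem_central E.
have eC := mulr_idemC cie; have Ce := mulr_Cidem cie; have CC := mulr_CC cie.
have eDC : e + (1 - e) = 1 by rewrite addrC subrK.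
have C0 : 1 - e != 0 by rewrite subr_eq0 eq_sym.
move: (1 - e) primeC eC Ce CC eDC C0 => c primeC ec ce cc eDc c0.
(* The ring generated by the idempotent c is Z/n for n the additive order
   of c. *)
pose n := #[c]%g; have n_gt1 : (1 < n)%N by rewrite order_gt1.
have modE k : c *+ (k %% (Zp_trunc n).+2)%N = c *+ k.
  by rewrite Zp_cast // -!FinRing.zmodXgE expg_mod_order.
pose F (tz : corner E * 'Z_n) : R := val tz.1 + c *+ (tz.2 : nat).
have FD : nmod_morphism F.
  split=> [|[s y] [t z]]; rewrite /F /= ?addr0 //.
  by rewrite modE mulrnDr addrACA.
have tc (t : corner E) : val t * c = 0 by rewrite -corner_idr -mulrA ec mulr0.
have ct (t : corner E) : c * val t = 0 by rewrite -corner_idl mulrA ce mul0r.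
have FM : monoid_morphism F.
  split=> [|[s y] [t z]]; first by rewrite /F corner_val1.
  rewrite /F [val _]corner_valM /= modE mulrDl !mulrDr !mulrnAl !mulrnAr tc ct cc.
  by rewrite !mul0rn addr0 add0r -mulrnA mulnC.
pose f : {rmorphism (corner E * 'Z_n)%type -> R} := HB.pack F
  (GRing.isNmodMorphism.Build _ _ _ FD) (GRing.isMonoidMorphism.Build _ _ _ FM).
exists n; split=> //; apply: (@bijective_ring_isomorphic _ _ f).
have eF tz : e * F tz = val tz.1.
  by rewrite mulrDr corner_idl mulrnAr ec mul0rn addr0.
have cF tz : c * F tz = c *+ tz.2 by rewrite mulrDr ct mulrnAr cc add0r.
have Finj : injective F.
  move=> [s y] [t z] Fst; congr (_, _).
    by apply: val_inj; rewrite -(eF (s, y)) Fst eF.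
  apply/val_inj/eqP; have /eqP := cF (s, y); rewrite Fst cF /=.
  rewrite -!FinRing.zmodXgE eq_expg_mod_order -/n.
  rewrite !modn_small; first by rewrite eq_sym.
    by rewrite -[X in (_ < X)%N](Zp_cast n_gt1) ltn_ord.
  by rewrite -[X in (_ < X)%N](Zp_cast n_gt1) ltn_ord.
have Fsurj x : exists tz, F tz == x.
  have [k xk] := primeC x; exists (to_corner E x, inZp k).
  by rewrite /F /= modE -xk -mulrDl eDc mul1r.
exists (fun x => xchoose (Fsurj x)) => [tz|x]; last exact/eqP/(xchooseP (Fsurj x)).
by apply: Finj; apply/eqP/(xchooseP (Fsurj (F tz))).
Qed.

End Decomposition.

Theorem theorem3p0p1 (R : finUnitRingType) (hR : minimal_simple R) :
  in_Delta R.
Proof.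
have [e prime_e nsole] := exists_primitive_nonsolvable_corner hR.1.
have [cie e0 _] := prime_e; pose E := NonzeroCentralIdempotent cie e0.
exists (corner E); split.
  split; first exact: corner_minimal_simple.
    exact: corner_card_prime_power.
  exact: corner_indecomposable.
have [e1|e1] := eqVneq e 1; first by left; apply: ring_isomorphic_corner1.
right; apply: ring_isomorphic_corner_prod => //=.
exact: (corner_complement_prime_ring hR cie nsole).
Qed.
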